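(* Let $\mathbf{K}$ be a consistent belief set (i.e. $\mathbf{K}=Cn(\mathbf{K})$ and $\mathbf{K}\not\vdash\bot$) and let $\odot$ be an operator on $\mathbf{K}$ (assigning to each sentence $\alpha\in\mathcal{L}$ a set of sentences $\mathbf{K}\odot\alpha$). Then the following three conditions are equivalent. (1) $\odot$ satisfies all of the following postulates (for all sentences $\alpha,\beta$): - Weak relative success: $\alpha\in\mathbf{K}\odot\alpha$ or $\mathbf{K}\odot\alpha\subseteq\mathbf{K}$. - Closure: $\mathbf{K}\odot\alpha=Cn(\mathbf{K}\odot\alpha)$. - Inclusion: $\mathbf{K}\odot\alpha\subseteq\mathbf{K}+\alpha$. - Consistency preservation: if $\mathbf{K}$ is consistent then $\mathbf{K}\odot\alpha$ is consistent. - Vacuity: if $\neg\alpha\notin\mathbf{K}$ then $\mathbf{K}+\alpha\subseteq\mathbf{K}\odot\alpha$. - Extensionality: if $\vdash\alpha\leftrightarrow\beta$ then $\mathbf{K}\odot\alpha=\mathbf{K}\odot\beta$. - Strict improvement: if $\alpha\in\mathbf{K}\odot\alpha$ and $\vdash\alpha\to\beta$, then $\beta\in\mathbf{K}\odot\beta$. - N-persistence: if $\neg\beta\in\mathbf{K}\odot\beta$ then $\neg\beta\in\mathbf{K}\odot\alpha$. - N-recovery: $\mathbf{K}\subseteq(\mathbf{K}\odot\alpha)+\neg\alpha$. - Disjunctive overlap: $\mathbf{K}\odot\alpha\cap\mathbf{K}\odot\beta\subseteq\mathbf{K}\odot(\alpha\vee\beta)$. - Disjunctive inclusion: if $\neg\alpha\notin\mathbf{K}\odot(\alpha\vee\beta)$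 then $\mathbf{K}\odot(\alpha\vee\beta)\subseteq\mathbf{K}\odot\alpha$. (2) $\odot$ is a system of spheres-based two level CL revision operator, i.e. there exists a two level system of spheres $(\mathbb S_i,\mathbb S)$ centred on $\|\mathbf{K}\|$ such that for every sentence $\alpha$: $$\mathbf{K}\odot\alpha=\begin{cases}\bigcap(S_\alpha\cap\|\alpha\|) & \text{if } S_\alpha\in\mathbb S_i,\\ \bigcap(\|\mathbf{K}\|\cup(S_\alpha\cap\|\alpha\|)) & \text{if } S_\alpha\in\mathbb S\setminus\mathbb S_i,\\ \mathbf{K} & \text{if } X\cap\|\alpha\|=\emptyset \text{ for all } X\in\mathbb S,\end{cases}$$ where $S_\alpha$ denotes the smallest sphere of $\mathbb S$ intersecting $\|\alpha\|$. (3) $\odot$ is a two level CL revision operator induced by an AGM revision operator $\star$ for $\mathbf{K}$ and sets $C_H,C_L\subseteq\mathcal{L}$, i.e. $\mathbf{K}\odot\alpha=\mathbf{K}\star\alpha$ if $\alpha\in C_H$, $\mathbf{K}\odot\alpha=(\mathbf{K}\star\alpha)\cap\mathbf{K}$ if $\alpha\in C_L$, and $\mathbf{K}\odot\alpha=\mathbf{K}$ if $\alpha\notin C_H\cup C_L$, where: - $C_L$ satisfies credibility of logical equivalents (if $\vdash\alpha\leftrightarrow\beta$ then $\alpha\in C_L$ iff $\beta\in C_L$) and element consistency (if $\alpha\in C_L$ then $\alpha\not\vdash\bot$); - $C_H\cap C_L=\emptyset$; - $C_H$ satisfies element consistency (if $\alpha\in C_H$ then $\alpha\not\vdash\bot$),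 credibility lower bounding (if $\mathbf{K}$ is consistent then $\mathbf{K}\subseteq C_H$) and single sentence closure (if $\alpha\in C_H$ then $Cn(\alpha)\subseteq C_H$); - for all $\alpha,\beta$: if $\alpha\notin C_H\cup C_L$ and $\beta\in C_H\cup C_L$, then $\neg\alpha\in\mathbf{K}\star\beta$; - for all $\alpha,\beta$: if $\alpha\notin C_H$ and $\beta\in C_H$, then $\neg\alpha\in\mathbf{K}\star\beta$.
   Context: $\mathcal{L}$ is a propositional language (also used for its set of formulas) with connectives $\neg,\wedge,\vee,\to,\leftrightarrow$; $Cn$ is a consequence operation satisfying inclusion, monotony, iteration, supraclassicality, compactness and the deduction property. $A\vdash\alpha$ means $\alpha\in Cn(A)$; $\vdash\alpha$ means $\alpha\in Cn(\emptyset)$; $Cn(\alpha)=Cn(\{\alpha\})$. A belief set is a set $\mathbf{K}$ with $\mathbf{K}=Cn(\mathbf{K})$, and $\mathbf{K}+\alpha=Cn(\mathbf{K}\cup\{\alpha\})$. A possible world is a maximal consistent subset of $\mathcal{L}$; $\mathcal{M}_{\mathcal{L}}$ is the set of all possible worlds. For $R\subseteq\mathcal{L}$, $\|R\|=\{M\in\mathcal{M}_{\mathcal{L}}:R\subseteq M\}$, and $\|\alpha\|=\|Cn(\{\alpha\})\|$. For a set $X$ of worlds, $\bigcap X$ is the intersection of its members (a belief set; $\bigcap\emptyset=\mathcal{L}$). An AGM revision operator $\star$ for $\mathbf{K}$ satisfies, for all $\alpha,\beta$: $\mathbf{K}\star\alpha=Cn(\mathbf{K}\star\alpha)$; $\alpha\in\mathbf{K}\star\alpha$;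 $\mathbf{K}\star\alpha\subseteq\mathbf{K}+\alpha$; if $\neg\alpha\notin\mathbf{K}$ then $\mathbf{K}+\alpha\subseteq\mathbf{K}\star\alpha$; if $\alpha$ is consistent then $\mathbf{K}\star\alpha$ is consistent; if $\vdash\alpha\leftrightarrow\beta$ then $\mathbf{K}\star\alpha=\mathbf{K}\star\beta$; $\mathbf{K}\star\alpha\cap\mathbf{K}\star\beta\subseteq\mathbf{K}\star(\alpha\vee\beta)$; if $\neg\alpha\notin\mathbf{K}\star(\alpha\vee\beta)$ then $\mathbf{K}\star(\alpha\vee\beta)\subseteq\mathbf{K}\star\alpha$. A two level system of spheres centred on $\|\mathbf{K}\|$ is a pair $(\mathbb S_i,\mathbb S)$ with $\mathbb S_i,\mathbb S\subseteq\mathcal{P}(\mathcal{M}_{\mathcal{L}})$ such that: (a) each of $\mathbb S$ and $\mathbb S_i$ is totally ordered by set inclusion, contains $\|\mathbf{K}\|$ as its $\subseteq$-minimum (i.e. $\|\mathbf{K}\|$ belongs to it and is contained in each of its members), and has the property that for every $\alpha\in\mathcal{L}$, if some element of it intersects $\|\alpha\|$ then there is a smallest element of it intersecting $\|\alpha\|$ (it is NOT required that $\mathcal{M}_{\mathcal{L}}$ belongs to it); (b) $\mathbb S_i\subseteq\mathbb S$; (c) if $X\in\mathbb S_i$ then $X\subseteq Y$ for all $Y\in\mathbb S\setminus\mathbb S_i$. Elements of $\mathbb S$ are called spheres. *)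

(* Defs.v *)
From mathcomp Require Import all_boot.
From mathcomp Require Import all_classical.

Set Implicit Arguments.
Unset Strict Implicit.
Unset Printing Implicit Defensive.

Local Open Scope classical_set_scope.

Inductive form (atom : Type) : Type :=
| Var of atom
| Neg of form atom
| And of form atom & form atom
| Or of form atom & form atom
| Imp of form atom & form atom
| Iff of form atom & form atom.

Section Logic.
Variable atom : Type.
Local Notation L := (form atom).

Fixpoint eval (v : atom -> bool) (a : L) : bool :=
  match a with
  | Var p => v p
  | Neg a => ~~ eval v a
  | And a b => eval v a && eval v b
  | Or a b => eval v a || eval v b
  | Imp a b => eval v a ==> eval v b
  | Iff a b => eval v a == eval v b
  end.

Definition classical_consequence (A : set L) : set L :=
  [set a | forall v, (forall b, A b -> eval v b) -> eval v a].

Record consequence_operation (Cn : set L -> set L) : Prop := {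
  Cn_inclusion : forall A, A `<=` Cn A;
  Cn_monotony : forall A B, A `<=` B -> Cn A `<=` Cn B;
  Cn_iteration : forall A, Cn (Cn A) = Cn A;
  Cn_supraclassicality : forall A, classical_consequence A `<=` Cn A;
  Cn_compactness : forall A a, Cn A a ->
    exists B, [/\ finite_set B, B `<=` A & Cn B a];
  Cn_deduction : forall A a b, Cn (A `|` [set a]) b -> Cn A (Imp a b)
}.

Variable Cn : set L -> set L.

(* [A |- falsum]; the language has no falsum constant, which is read as an
   arbitrary explicit contradiction. *)
Definition entails_falsum (A : set L) : Prop := exists a, Cn A (And a (Neg a)).

Definition consistent (A : set L) : Prop := ~ entails_falsum A.

Definition belief_set (K : set L) : Prop := K = Cn K.

Definition expansion (K : set L) (a : L) : set L := Cn (K `|` [set a]).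

Definition worlds : set (set L) :=
  [set M | consistent M /\ forall N, consistent N -> M `<=` N -> N = M].

Definition worlds_of (R : set L) : set (set L) :=
  [set M | worlds M /\ R `<=` M].

Definition worlds_of_form (a : L) : set (set L) := worlds_of (Cn [set a]).

Definition meet_worlds (X : set (set L)) : set L := \bigcap_(M in X) M.

Record AGM_revision (K : set L) (star : L -> set L) : Prop := {
  AGM_closure : forall a, star a = Cn (star a);
  AGM_success : forall a, star a a;
  AGM_inclusion : forall a, star a `<=` expansion K a;
  AGM_vacuity : forall a, ~ K (Neg a) -> expansion K a `<=` star a;
  AGM_consistency : forall a, consistent [set a] -> consistent (star a);
  AGM_extensionality : forall a b, Cn set0 (Iff a b) -> star a = star b;
  AGM_disjunctive_overlap : forall a b, star a `&` star b `<=` star (Or a b);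
  AGM_disjunctive_inclusion : forall a b,
    ~ star (Or a b) (Neg a) -> star (Or a b) `<=` star a
}.

Record CL2_postulates (K : set L) (odot : L -> set L) : Prop := {
  weak_relative_success : forall a, odot a a \/ odot a `<=` K;
  closure : forall a, odot a = Cn (odot a);
  inclusion : forall a, odot a `<=` expansion K a;
  consistency_preservation : forall a, consistent K -> consistent (odot a);
  vacuity : forall a, ~ K (Neg a) -> expansion K a `<=` odot a;
  extensionality : forall a b, Cn set0 (Iff a b) -> odot a = odot b;
  strict_improvement : forall a b,
    odot a a -> Cn set0 (Imp a b) -> odot b b;
  N_persistence : forall a b, odot b (Neg b) -> odot a (Neg b);
  N_recovery : forall a, K `<=` expansion (odot a) (Neg a);
  disjunctive_overlap : forall a b, odot a `&` odot b `<=` odot (Or a b);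
  disjunctive_inclusion : forall a b,
    ~ odot (Or a b) (Neg a) -> odot (Or a b) `<=` odot a
}.

Definition intersects (X Y : set (set L)) : Prop := X `&` Y !=set0.

Definition smallest_intersecting (S : set (set (set L))) (a : L)
    (X : set (set L)) : Prop :=
  [/\ S X, intersects X (worlds_of_form a) &
      forall Y, S Y -> intersects Y (worlds_of_form a) -> X `<=` Y].

(* The set of all worlds is not required to be a sphere. *)
Record sphere_system (K : set L) (S : set (set (set L))) : Prop := {
  spheres_worlds : forall X, S X -> X `<=` worlds;
  spheres_total : forall X Y, S X -> S Y -> X `<=` Y \/ Y `<=` X;
  spheres_center : S (worlds_of K);
  spheres_min : forall X, S X -> worlds_of K `<=` X;
  spheres_smallest : forall a,
    (exists2 X, S X & intersects X (worlds_of_form a)) ->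
    exists X, smallest_intersecting S a X
}.

Record two_level_sphere_system (K : set L) (Si S : set (set (set L)))
    : Prop := {
  two_level_outer : sphere_system K S;
  two_level_inner : sphere_system K Si;
  two_level_sub : Si `<=` S;
  two_level_below : forall X Y, Si X -> (S `\` Si) Y -> X `<=` Y
}.

(* [X] ranges over the (unique, if any) smallest sphere of [S] meeting the
   worlds of [a]. *)
Definition sphere_based_CL2 (K : set L) (odot : L -> set L) : Prop :=
  exists Si S, two_level_sphere_system K Si S /\
    forall a,
    [/\ forall X, smallest_intersecting S a X -> Si X ->
          odot a = meet_worlds (X `&` worlds_of_form a),
        forall X, smallest_intersecting S a X -> (S `\` Si) X ->
          odot a = meet_worlds (worlds_of K `|` (X `&` worlds_of_form a)) &
        (forall X, S X -> X `&` worlds_of_form a = set0) -> odot a = K].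

Definition closed_under_equivalents (C : set L) : Prop :=
  forall a b, Cn set0 (Iff a b) -> (C a <-> C b).

Definition element_consistency (C : set L) : Prop :=
  forall a, C a -> consistent [set a].

Definition credibility_lower_bounding (K C : set L) : Prop :=
  consistent K -> K `<=` C.

Definition single_sentence_closure (C : set L) : Prop :=
  forall a, C a -> Cn [set a] `<=` C.

Definition revision_induced_CL2 (K : set L) (odot : L -> set L) : Prop :=
  exists (star : L -> set L) (CH CL : set L),
  [/\ AGM_revision K star,
      forall a, [/\ CH a -> odot a = star a,
                    CL a -> odot a = star a `&` K &
                    ~ (CH `|` CL) a -> odot a = K],
      closed_under_equivalents CL /\ element_consistency CL,
      CH `&` CL = set0 &
      [/\ element_consistency CH,
          credibility_lower_bounding K CH,
          single_sentence_closure CH,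
          forall a b, ~ (CH `|` CL) a -> (CH `|` CL) b -> star b (Neg a) &
          forall a b, ~ CH a -> CH b -> star b (Neg a)]].

End Logic.

(* Main.v *)
(* For a belief set the consequence relation is containment in all maximal
   consistent extensions (Lindenbaum), so revision can be described by sets of
   worlds. The implications go round (1) => (3) => (2) => (1).

   (1) => (3): take [C_H = {a | a in K.a}] and [C_L] the sentences such that
   neither [a] nor [Neg a] is in [K.a], where [K.a] is the given operator.
   Revise by [Cn (K.a + a)] when [a] is in one of them and by [Cn a] otherwise.
   N-recovery says that the worlds of [K.a] refuting [a] are worlds of [K],
   which gives [K.a = (K * a) meet K] on [C_L] and reduces the AGM postulates
   to those of the operator.

   (3) => (2): use Grove's spheres [S_a], the union of the worlds of [K * c]
   over the consequences [c] of [a], with [a] in [C_H] for the inner level and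
   in [C_H + C_L] for the outer one. The two compatibility conditions between
   the revision and [C_H], [C_L] say that a sentence true at some world of one
   of the two levels belongs to the corresponding set.

   (2) => (1): a smallest sphere for [Or a b] that meets the worlds of [a] is
   also a smallest sphere for [a]. *)
Require Import Defs.
From mathcomp Require Import all_boot.
From mathcomp Require Import all_classical.

Set Implicit Arguments.
Unset Strict Implicit.
Unset Printing Implicit Defensive.

Local Open Scope classical_set_scope.

(** Together with compactness this makes the sets that do not entail a given sentence closed under
    unions of chains. The first alternative accounts for the empty chain. *)
Lemma finite_subset_chain_bigcup (T : Type) (A B : set T) (F : set (set T)) :
  finite_set B -> total_on F subset -> B `<=` A `|` \bigcup_(X in F) X ->
  B `<=` A \/ exists2 X, F X & B `<=` A `|` X.
Proof.
(* Classically every type has a decidable equality, on which the enumeration of [B] by a sequence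
   relies. *)
elim/Peq: T => T in A B F *.
move=> /finite_seqP[s ->] totF; elim: s => [|x s IH] sub; first by left.
have [|sA|[X FX sX]] := IH.
- by move=> y ys; apply: sub; rewrite /= inE; apply/orP; right.
- have [|Ax|[X FX Xx]] := sub x; first by rewrite /= inE eqxx.
    by left=> y; rewrite /= inE => /orP[/eqP ->//|/sA].
  right; exists X => // y; rewrite /= inE => /orP[/eqP ->|/sA]; first by right.
  by left.
- right; have [|Ax|[Y FY Yx]] := sub x; first by rewrite /= inE eqxx.
    by exists X => // y; rewrite /= inE => /orP[/eqP ->|/sX//]; left.
  have [XY|YX] := totF _ _ FX FY.
    exists Y => // y; rewrite /= inE => /orP[/eqP ->|/sX[|/XY]]; by [right|left|right].
  exists X => // y; rewrite /= inE => /orP[/eqP ->|/sX//].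
  by right; apply: YX.
Qed.

(** * Consequence operations, possible worlds and Lindenbaum's lemma *)

Section ConsequenceOperation.
Variables (atom : Type) (Cn : set (form atom) -> set (form atom)).
Hypothesis hCn : consequence_operation Cn.
Implicit Types (A B K M N : set (form atom)) (a b c x y : form atom).

Lemma Cn_trans A B : B `<=` Cn A -> Cn B `<=` Cn A.
Proof. by move=> /(Cn_monotony hCn); rewrite (Cn_iteration hCn). Qed.

Lemma Cn_taut A x : (forall v, eval v x) -> Cn A x.
Proof. by move=> tx; apply: (Cn_supraclassicality hCn) => v _; apply: tx. Qed.

Lemma Cn_taut2 A a b x : Cn A a -> Cn A b ->
  (forall v, eval v a -> eval v b -> eval v x) -> Cn A x.
Proof.
move=> Aa Ab ab_x; apply: (@Cn_trans A [set c | c = a \/ c = b]).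
  by move=> c [->|->].
apply: (Cn_supraclassicality hCn) => v vab.
by apply: ab_x; apply: vab; [left|right].
Qed.

Lemma Cn_taut1 A a x :
  Cn A a -> (forall v, eval v a -> eval v x) -> Cn A x.
Proof. by move=> Aa ax; apply: (Cn_taut2 Aa Aa) => v /ax. Qed.

Lemma Cn_explosion A a x : Cn A a -> Cn A (Neg a) -> Cn A x.
Proof. by move=> Aa An; apply: (Cn_taut2 Aa An) => v /= ->. Qed.

Lemma entails_falsumP A a : Cn A a -> Cn A (Neg a) -> entails_falsum Cn A.
Proof. by move=> Aa An; exists a; apply: Cn_explosion Aa An. Qed.

Lemma Cn_mp A a b : Cn A (Imp a b) -> Cn A a -> Cn A b.
Proof. by move=> Aab Aa; apply: (Cn_taut2 Aab Aa) => v /implyP. Qed.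

Lemma Cn_Or_l A a b : Cn A a -> Cn A (Or a b).
Proof. by move=> Aa; apply: (Cn_taut1 Aa) => v /= ->. Qed.

Lemma Cn_Or_r A a b : Cn A b -> Cn A (Or a b).
Proof. by move=> Ab; apply: (Cn_taut1 Ab) => v /= ->; rewrite orbT. Qed.

Lemma Cn_Imp_refl A a : Cn A (Imp a a).
Proof. by apply: Cn_taut => v; apply: implybb. Qed.

Lemma Cn_form_refl a : Cn [set a] a.
Proof. exact: (Cn_inclusion hCn). Qed.

Lemma expansion_Imp A a b : expansion Cn A a b <-> Cn A (Imp a b).
Proof.
split; first exact: (Cn_deduction hCn).
move=> Aab; apply: (@Cn_mp _ a).
  by apply: (Cn_monotony hCn) Aab => ?; left.
by apply: (Cn_inclusion hCn); right.
Qed.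

Lemma Cn_form_Imp a b : Cn [set a] b <-> Cn set0 (Imp a b).
Proof. by rewrite -expansion_Imp /expansion set0U. Qed.

Lemma sub_expansion A a : A `<=` expansion Cn A a.
Proof. by move=> x Ax; apply: (Cn_inclusion hCn); left. Qed.

Lemma expansion_self A a : expansion Cn A a a.
Proof. by apply: (Cn_inclusion hCn); right. Qed.

Lemma inconsistent_expansion A a :
  entails_falsum Cn (A `|` [set a]) -> Cn A (Neg a).
Proof.
move=> [c /expansion_Imp Ac]; apply: (Cn_taut1 Ac) => v /=.
by case: (eval v a) => //=; case: (eval v c).
Qed.

Lemma not_Cn_consistent A x : ~ Cn A x -> consistent Cn A.
Proof. by move=> nAx [c Ac]; apply: nAx; apply: (Cn_taut1 Ac) => v /= /andP[->]. Qed.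

Lemma world_Cn M : worlds Cn M -> Cn M `<=` M.
Proof.
move=> [Mcons Mmax]; suff -> : Cn M = M by [].
apply: Mmax; last exact: (Cn_inclusion hCn).
by move=> [a]; rewrite (Cn_iteration hCn) => Ma; apply: Mcons; exists a.
Qed.

Lemma world_NegP M a : worlds Cn M -> M (Neg a) <-> ~ M a.
Proof.
move=> wM; have [Mcons Mmax] := wM; split=> [Mn Ma|nMa].
  by apply: Mcons; apply: (@entails_falsumP _ a); apply: (Cn_inclusion hCn).
apply: world_Cn => //; apply: inconsistent_expansion; apply: contrapT => Macons.
apply: nMa; rewrite -(Mmax _ Macons); first by right.
by move=> ?; left.
Qed.

Lemma world_taut2 M a b x : worlds Cn M -> M a -> M b ->
  (forall v, eval v a -> eval v b -> eval v x) -> M x.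
Proof.
move=> wM Ma Mb abx; apply: world_Cn => //.
by apply: Cn_taut2 abx; apply: (Cn_inclusion hCn).
Qed.

Lemma world_OrP M a b : worlds Cn M -> M (Or a b) <-> M a \/ M b.
Proof.
move=> wM; split=> [Mab|].
  have [Ma|nMa] := pselect (M a); [by left|right].
  have /(world_NegP _ wM) Mn := nMa.
  by apply: (world_taut2 wM Mab Mn) => v /=; case: (eval v a).
by case=> Mx; apply: (world_taut2 wM Mx Mx) => v /= ->; rewrite ?orbT.
Qed.

Lemma world_of_formP M a : worlds_of_form Cn a M <-> worlds Cn M /\ M a.
Proof.
split=> [[wM aM]|[wM Ma]]; split=> //.
  by apply: aM; apply: (Cn_inclusion hCn).
apply: subset_trans (world_Cn wM); apply: (Cn_monotony hCn).
by move=> _ ->.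
Qed.

Lemma Cn_form_world a c M : Cn [set a] c -> worlds Cn M -> M a -> M c.
Proof.
move=> ac wM Ma; have [_] : worlds_of_form Cn a M by apply/world_of_formP.
exact.
Qed.

(* A set maximal among the supersets of [A] not entailing [x] is a world: it
   contains [Neg x], so refuting a new element amounts to deriving [x]. *)
Lemma Lindenbaum A x : ~ Cn A x -> exists M, [/\ worlds Cn M, A `<=` M & ~ M x].
Proof.
(* Zorn's lemma for unions prescribes no subset of the maximal set, so [A] is adjoined inside the
   property. *)
move=> nAx; pose P N := ~ Cn (A `|` N) x.
have [F FP totF|N [PN maxN]] := @Zorn_bigcup _ P.
  move=> /(Cn_compactness hCn)[B [finB sB Bx]].
  have [sBA|[X FX sBX]] := finite_subset_chain_bigcup finB totF sB.
    by apply: nAx; apply: (Cn_monotony hCn) Bx.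
  by apply: (FP _ FX); apply: (Cn_monotony hCn) Bx.
have new y : ~ (A `|` N) y -> Cn (A `|` N) (Imp y x).
  move=> nNy; have := maxN (N `|` [set y]); rewrite /P setUA => H.
  apply/expansion_Imp; apply: contrapT; apply: H; split; first by move=> ?; left.
  by move=> /(_ y (or_intror erefl)) Ny; apply: nNy; right.
have Nnx : (A `|` N) (Neg x).
  apply: contrapT => /new H; apply: PN; apply: (Cn_taut1 H) => v /=.
  by case: (eval v x).
exists (A `|` N); split; last by move=> ?; apply: PN; apply: (Cn_inclusion hCn).
  split=> [|N' N'cons sub]; first exact: not_Cn_consistent PN.
  apply/seteqP; split=> // y N'y; apply: contrapT => /new Nyx.
  apply: N'cons; apply: (@entails_falsumP _ x).
    apply: (@Cn_mp _ y); last exact: (Cn_inclusion hCn).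
    by apply: (Cn_monotony hCn) Nyx.
  by apply: (Cn_inclusion hCn); apply: sub.
by move=> ?; left.
Qed.

Lemma Cn_worlds A x :
  (forall M, worlds Cn M -> A `<=` M -> M x) -> Cn A x.
Proof.
by move=> H; apply: contrapT => /Lindenbaum[M [wM AM]]; apply; apply: H.
Qed.

(* The formula [x] only witnesses that the language is nonempty. *)
Lemma consistent_world A x :
  consistent Cn A -> exists2 M, worlds Cn M & A `<=` M.
Proof.
move=> Acons; have [|M [wM AM _]] := @Lindenbaum A (And x (Neg x)).
  by move=> Ax; apply: Acons; exists x.
by exists M.
Qed.

Lemma world_consistent A M : worlds Cn M -> A `<=` M -> consistent Cn A.
Proof.
by move=> [Mcons _] AM [a Aa]; apply: Mcons; exists a; apply: (Cn_monotony hCn) Aa.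
Qed.

Lemma belief_set_worlds K x : belief_set Cn K ->
  K x <-> forall M, worlds Cn M -> K `<=` M -> M x.
Proof.
by move=> hK; split=> [Kx M _|H]; [exact|rewrite hK; exact: Cn_worlds].
Qed.

Lemma consistent_belief_set K a :
  belief_set Cn K -> consistent Cn K -> K a -> ~ K (Neg a).
Proof.
move=> hK Kcons Ka Kn; apply: Kcons.
by apply: (@entails_falsumP _ a); apply: (Cn_inclusion hCn).
Qed.

Lemma expansion_belief_set K a : belief_set Cn K -> K a -> expansion Cn K a = K.
Proof.
move=> hK Ka; apply/seteqP; split; last exact: sub_expansion.
by rewrite {2}hK; apply: Cn_trans; rewrite -hK => x [//|->].
Qed.

(** An [x] of [A] outside [M] turns each [y] of [B] into the common element [Or x y], and worlds are
    prime. Through this lemma the overlap postulates become statements about worlds. *)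
Lemma world_meet_belief_sets A B C M : belief_set Cn A -> belief_set Cn B ->
  A `&` B `<=` C -> worlds Cn M -> C `<=` M -> A `<=` M \/ B `<=` M.
Proof.
move=> hA hB ABC wM CM; have [|nAM] := pselect (A `<=` M); [by left|right=> y By].
have /existsNP[x /not_implyP[Ax nMx]] := nAM.
suff /(world_OrP x y wM)[//|//] : M (Or x y).
apply: CM; apply: ABC; split; [rewrite hA|rewrite hB].
  by apply: Cn_Or_l; apply: (Cn_inclusion hCn).
by apply: Cn_Or_r; apply: (Cn_inclusion hCn).
Qed.

Lemma meet_worlds_belief_set (X : set (set (form atom))) :
  X `<=` worlds Cn -> belief_set Cn (meet_worlds X).
Proof.
move=> Xw; apply/seteqP; split; first exact: (Cn_inclusion hCn).
move=> x Xx M XM; apply: world_Cn; first exact: Xw.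
by apply: (Cn_monotony hCn) Xx => y; apply.
Qed.

End ConsequenceOperation.

(** * From the postulates to an AGM revision with two levels of credibility *)

Section PostulatesToRevision.
Variables (atom : Type) (Cn : set (form atom) -> set (form atom)).
Hypothesis hCn : consequence_operation Cn.
Variables (K : set (form atom)) (odot : form atom -> set (form atom)).
Hypotheses (hK : belief_set Cn K) (hKcons : consistent Cn K).
Hypothesis hodot : CL2_postulates Cn K odot.
Implicit Types (M : set (form atom)) (a b c x : form atom).

Lemma CL2_not_both a : odot a a -> ~ odot a (Neg a).
Proof.
move=> aa; have hK' : belief_set Cn (odot a) := Defs.closure hodot a.
exact: (consistent_belief_set hCn hK' (consistency_preservation hodot hKcons) aa).
Qed.

Lemma CL2_expansion a : ~ K (Neg a) -> odot a = expansion Cn K a.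
Proof.
by move=> nK; apply/seteqP; split; [exact: inclusion|exact: vacuity].
Qed.

Lemma CL2_believed a : K a -> odot a = K.
Proof.
move=> Ka; rewrite CL2_expansion ?expansion_belief_set //.
exact: (consistent_belief_set hCn hK hKcons Ka).
Qed.

(** Since [a] fails, weak relative success gives one inclusion. Adding [Neg a] to [odot a] changes
    nothing, so N-recovery gives the other. *)
Lemma CL2_rejected a : odot a (Neg a) -> odot a = K.
Proof.
move=> an; apply/seteqP; split.
  by have [/CL2_not_both|] := weak_relative_success hodot a.
move=> x /(@N_recovery _ _ _ _ hodot a).
by rewrite (expansion_belief_set hCn (Defs.closure hodot a)).
Qed.

Lemma CL2_recovery_world a M :
  worlds Cn M -> odot a `<=` M -> ~ M a -> K `<=` M.
Proof.
move=> wM aM /(world_NegP hCn _ wM) Mn x /(@N_recovery _ _ _ _ hodot a) ax.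
apply: (world_Cn hCn wM); apply: (Cn_monotony hCn) ax.
by move=> y [/aM//|->].
Qed.

Lemma CL2_overlap_world a b M : worlds Cn M ->
  odot (Or a b) `<=` M -> odot a `<=` M \/ odot b `<=` M.
Proof.
exact: (world_meet_belief_sets hCn (Defs.closure hodot a) (Defs.closure hodot b)
  (disjunctive_overlap hodot (a := a) (b := b))).
Qed.

(* On rejected sentences [odot] carries no information about the order of the
   worlds, and full meet revision is as good as any. *)
Definition CL2_star a : set (form atom) :=
  if pselect (odot a (Neg a)) then Cn [set a] else expansion Cn (odot a) a.

Lemma CL2_star_rejected a : odot a (Neg a) -> CL2_star a = Cn [set a].
Proof. by rewrite /CL2_star; case: pselect. Qed.

Lemma CL2_star_credible a :
  ~ odot a (Neg a) -> CL2_star a = expansion Cn (odot a) a.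
Proof. by rewrite /CL2_star; case: pselect. Qed.

Lemma CL2_star_sub_expansion a : CL2_star a `<=` expansion Cn (odot a) a.
Proof.
rewrite /CL2_star; case: pselect => /= _; last exact: subset_refl.
by apply: (Cn_monotony hCn) => x ->; right.
Qed.

Lemma CL2_star_closed a : belief_set Cn (CL2_star a).
Proof.
by rewrite /CL2_star /expansion; case: pselect => /= _; rewrite /belief_set (Cn_iteration hCn).
Qed.

Lemma CL2_star_self a : CL2_star a a.
Proof.
rewrite /CL2_star; case: pselect => /= _; last exact: expansion_self.
exact: (Cn_inclusion hCn).
Qed.

Lemma CL2_star_world a M : worlds Cn M -> odot a `<=` M -> M a -> CL2_star a `<=` M.
Proof.
move=> wM aM Ma x /CL2_star_sub_expansion ax; apply: (world_Cn hCn wM).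
by apply: (Cn_monotony hCn) ax => y [/aM//|->].
Qed.

(** N-persistence carries the negated disjunction into [odot a] and [odot b], where it entails the
    negation of each disjunct. *)
Lemma CL2_Or_rejected a b : odot (Or a b) (Neg (Or a b)) ->
  odot a (Neg a) /\ odot b (Neg b).
Proof.
move=> n; split; rewrite (Defs.closure hodot);
  apply: (Cn_taut1 hCn (Cn_inclusion hCn (N_persistence hodot _ n))) => v /=;
  by rewrite negb_or => /andP[].
Qed.

(** The overlap of [odot] provides a disjunct [c] with [odot c] contained in [M], but [c] might be
    false at [M]. If [M] is not a world of [K], recovery excludes this. If it is, the disjunct true
    at [M] can be taken instead, because for it [odot] is the expansion of [K]. *)
Lemma CL2_star_overlap_world a b M : worlds Cn M ->
  CL2_star (Or a b) `<=` M -> CL2_star a `<=` M \/ CL2_star b `<=` M.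
Proof.
move=> wM abM; have Mab := abM _ (CL2_star_self (Or a b)).
have [rej|cred] := pselect (odot (Or a b) (Neg (Or a b))).
  have [ra rb] := CL2_Or_rejected rej; rewrite !CL2_star_rejected //.
  by have [Ma|Mb] := (world_OrP hCn _ _ wM).1 Mab; [left|right] => x ax;
    apply: (Cn_form_world hCn ax wM).
have {}abM : odot (Or a b) `<=` M.
  by apply: subset_trans abM; rewrite CL2_star_credible //; apply: sub_expansion.
have Kcase c : K `<=` M -> M c -> CL2_star c `<=` M.
  move=> KM Mc; apply: CL2_star_world => // x.
  rewrite CL2_expansion; last by move=> /KM /(world_NegP hCn _ wM).
  move=> cx; apply: (world_Cn hCn wM); apply: (Cn_monotony hCn) cx.
  by move=> y [/KM//|->].
have Mcase : odot a `<=` M \/ odot b `<=` M by exact: CL2_overlap_world.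
have [KM|nKM] := pselect (K `<=` M).
  by have [Ma|Mb] := (world_OrP hCn _ _ wM).1 Mab; [left|right]; apply: Kcase.
case: Mcase => cM; [left|right]; apply: CL2_star_world => //;
  by apply: contrapT => nMc; apply: nKM; apply: (CL2_recovery_world wM cM).
Qed.

Lemma CL2_star_AGM : AGM_revision Cn K CL2_star.
Proof.
split.
- exact: CL2_star_closed.
- exact: CL2_star_self.
- move=> a; apply: subset_trans (@CL2_star_sub_expansion a) _.
  apply: (Cn_trans hCn) => x [|->]; first exact: inclusion.
  exact: expansion_self.
- move=> a nK; have E := CL2_expansion nK.
  rewrite CL2_star_credible E; first exact: sub_expansion.
  rewrite -E; apply: CL2_not_both; rewrite E; exact: expansion_self.
- move=> a acons; have [rej|cred] := pselect (odot a (Neg a)).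
    rewrite CL2_star_rejected // => -[c]; rewrite (Cn_iteration hCn) => ac.
    by apply: acons; exists c.
  rewrite CL2_star_credible // => -[c]; rewrite /expansion (Cn_iteration hCn) => ac.
  by apply: cred; rewrite (Defs.closure hodot); apply: (inconsistent_expansion hCn); exists c.
- move=> a b ab; have Eo := Defs.extensionality hodot ab.
  have [ab1 ab2] : Cn set0 (Imp a b) /\ Cn set0 (Imp b a).
    by split; apply: (Cn_taut1 hCn ab) => v /= /eqP ->; exact: implybb.
  (* [CL2_star] branches on rejection, so equivalent sentences have to be rejected together. *)
  have En : odot a (Neg a) <-> odot a (Neg b).
    rewrite (Defs.closure hodot a).
    have mono : Cn set0 `<=` Cn (odot a) by exact: (Cn_monotony hCn).
    by split=> h; apply: (Cn_taut2 hCn h (mono _ ab)) => v /=; case: (eval v a); case: (eval v b).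
  have [rej|cred] := pselect (odot a (Neg a)).
    rewrite !CL2_star_rejected // -?Eo -?En //.
    by apply/seteqP; split; apply: (Cn_trans hCn) => _ ->; apply/(Cn_form_Imp hCn).
  rewrite !CL2_star_credible // -?Eo -?En //.
  have mono A : Cn set0 `<=` Cn A by exact: (Cn_monotony hCn).
  by apply/seteqP; split; apply: (Cn_trans hCn) => x [ax|->];
    [apply: sub_expansion|apply: (Cn_mp hCn (mono _ _ ab2)); apply: expansion_self
    |apply: sub_expansion|apply: (Cn_mp hCn (mono _ _ ab1)); apply: expansion_self].
- move=> a b x [ax bx]; apply/(belief_set_worlds hCn _ (CL2_star_closed _)) => M wM.
  by case/(CL2_star_overlap_world wM); apply.
- move=> a b nna.
  have aab := Cn_Or_l hCn b (Cn_form_refl hCn a).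
  have [rej|cred] := pselect (odot (Or a b) (Neg (Or a b))).
    rewrite CL2_star_rejected // (CL2_star_closed a); apply: (Cn_trans hCn) => _ ->.
    apply: (Cn_mp hCn _ (Cn_inclusion hCn (CL2_star_self a))).
    by apply: (Cn_monotony hCn (@sub0set _ _)); apply/(Cn_form_Imp hCn).
  rewrite CL2_star_credible // in nna *.
  have nna' : ~ odot (Or a b) (Neg a) by move=> h; apply: nna; apply: sub_expansion.
  (* Were [a] rejected, N-persistence would put [Neg a] into [odot (Or a b)], against [nna']. *)
  rewrite CL2_star_credible; last by move=> /(N_persistence hodot (Or a b)).
  apply: (Cn_trans hCn) => x [|->].
    move=> /(disjunctive_inclusion hodot nna'); exact: sub_expansion.
  by apply: (Cn_monotony hCn) aab => ? ->; right.
Qed.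

(** By strict improvement [Or a b] is accepted. If its revision contains [Neg a], it cannot contain
    [Neg b], and disjunctive inclusion passes [Neg a] on to [odot b]. Otherwise [Or a b] reaches
    [odot a], which lies in [K] as [a] fails; [K] also contains [Neg a] by vacuity, hence [b], so
    [odot b] is [K]. *)
Lemma CL2_high_low a b : ~ odot a a -> odot b b -> odot b (Neg a).
Proof.
move=> na bb.
have abab : odot (Or a b) (Or a b).
  apply: (strict_improvement hodot bb).
  by apply: (Cn_taut hCn) => v /=; case: (eval v a); case: (eval v b).
have [nab|nnab] := pselect (odot (Or a b) (Neg a)).
  have E : Cn set0 (Iff (Or a b) (Or b a)).
    by apply: (Cn_taut hCn) => v /=; rewrite orbC.
  move: (nab); rewrite (Defs.extensionality hodot E).
  apply: (disjunctive_inclusion hodot); rewrite -(Defs.extensionality hodot E) => nbab.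
  apply: (CL2_not_both abab); rewrite (Defs.closure hodot).
  apply: (Cn_taut2 hCn (Cn_inclusion hCn nab) (Cn_inclusion hCn nbab)) => v /=.
  by rewrite negb_or => -> ->.
have aab := disjunctive_inclusion hodot nnab abab.
have Kn : K (Neg a).
  apply: contrapT => nKn; apply: na; rewrite CL2_expansion //; exact: expansion_self.
have [//|aK] := weak_relative_success hodot a.
rewrite CL2_believed // hK.
apply: (Cn_taut2 hCn (Cn_inclusion hCn Kn) (Cn_inclusion hCn (aK _ aab))) => v /=.
by case: (eval v a).
Qed.

Lemma postulates_revision_induced : revision_induced_CL2 Cn K odot.
Proof.
pose CL := [set a | ~ odot a a /\ ~ odot a (Neg a)].
have rejE a : ~ ([set a | odot a a] `|` CL) a -> odot a (Neg a).
  move=> /not_orP[na nL]; apply: contrapT => nn; exact: nL.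
exists CL2_star, [set a | odot a a], CL; split.
- exact: CL2_star_AGM.
- move=> a; split=> [/= aa|/= [na nn]|/rejE /CL2_rejected //].
    rewrite CL2_star_credible; last exact: CL2_not_both.
    by rewrite (expansion_belief_set hCn (Defs.closure hodot a)).
  rewrite CL2_star_credible //; apply/seteqP; split=> x.
    move=> ax; split; first exact: sub_expansion.
    by have [//|] := weak_relative_success hodot a; apply.
  (* Membership in the revision gives [Imp a x] in [odot a], and N-recovery gives
     [Imp (Neg a) x]. *)
  move=> [/(expansion_Imp hCn) ax /(@N_recovery _ _ _ _ hodot a) /(expansion_Imp hCn) nax].
  rewrite (Defs.closure hodot); apply: (Cn_taut2 hCn ax nax) => v /=.
  by case: (eval v a).
- split.
    suff imp a b : Cn set0 (Iff a b) -> CL a -> CL b.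
      move=> a b ab; split; apply: imp => //.
      by apply: (Cn_taut1 hCn ab) => v /=; rewrite eq_sym.
    move=> ab [na nn]; rewrite /CL /= -(Defs.extensionality hodot ab).
    rewrite (Defs.closure hodot a) in na nn *.
    have mono : Cn set0 `<=` Cn (odot a) by exact: (Cn_monotony hCn).
    split=> h; [apply: na|apply: nn];
      by apply: (Cn_taut2 hCn h (mono _ ab)) => v /=; case: (eval v a); case: (eval v b).
  move=> a [_ nn] incons; apply: nn; rewrite (Defs.closure hodot).
  apply: (Cn_monotony hCn (@sub0set _ _)); apply: (inconsistent_expansion hCn).
  by rewrite set0U.
- by apply/seteqP; split=> // a [/= aa []].
- split.
  + move=> a /= aa [c ac]; apply: (consistency_preservation hodot hKcons (a := a)).
    by exists c; apply: (Cn_monotony hCn) ac => _ ->.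
  + by move=> _ a Ka /=; rewrite CL2_believed.
  + by move=> a /= aa b /(Cn_form_Imp hCn) ab; apply: (strict_improvement hodot aa ab).
  + move=> a b /rejE an Cb.
    have nb : ~ odot b (Neg b) by case: Cb => [/CL2_not_both//|[]].
    by rewrite CL2_star_credible //; apply: (sub_expansion hCn); apply: (N_persistence hodot b an).
  + move=> a b /= na bb; rewrite CL2_star_credible; last exact: CL2_not_both.
    by apply: (sub_expansion hCn); apply: CL2_high_low.
Qed.

End PostulatesToRevision.

(** * Grove spheres of an AGM revision *)

Section RevisionToSpheres.
Variables (atom : Type) (Cn : set (form atom) -> set (form atom)).
Hypothesis hCn : consequence_operation Cn.
Variables (K : set (form atom)) (star : form atom -> set (form atom)).
Hypotheses (hK : belief_set Cn K) (hKcons : consistent Cn K).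
Hypothesis hstar : AGM_revision Cn K star.
Implicit Types (M : set (form atom)) (X Y : set (set (form atom))).
Implicit Types a b c x : form atom.

Local Notation best a := (worlds_of Cn (star a)).

Lemma AGM_world_self a M : best a M -> M a.
Proof. by move=> [_]; apply; apply: AGM_success hstar a. Qed.

Lemma AGM_world_Or a b M : best (Or a b) M -> best a M \/ best b M.
Proof.
move=> [wM abM]; have hcl := AGM_closure hstar.
have := world_meet_belief_sets hCn (hcl a) (hcl b)
  (AGM_disjunctive_overlap hstar (a := a) (b := b)) wM abM.
by case; [left|right].
Qed.

(** As [a] entails [c], the sentence [c] splits into [a] and [And c (Neg a)]. By overlap a best
    world of [c] is best for one of the two, and the second is false at [M]. *)
Lemma AGM_world_restrict a c M : Cn [set a] c -> best c M -> M a -> best a M.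
Proof.
move=> /(Cn_form_Imp hCn) ac cM Ma.
have E : Cn set0 (Iff c (Or a (And c (Neg a)))).
  apply: (Cn_taut1 hCn ac) => v /=.
  by case: (eval v a); case: (eval v c).
move: cM; rewrite (AGM_extensionality hstar E) => /AGM_world_Or[//|cM].
have [wM _] := cM; have Mn := AGM_world_self cM.
suff /(world_NegP hCn _ wM) : M (Neg a) by [].
by apply: (world_taut2 hCn wM Mn Mn) => v /= /andP[].
Qed.

(** The world [M] keeps [Neg a] out of [star c], and [c] is equivalent to [Or a c], so disjunctive
    inclusion gives [star c] inside [star a]. *)
Lemma AGM_world_extend a c M N : Cn [set a] c -> best c M -> M a ->
  best a N -> best c N.
Proof.
move=> /(Cn_form_Imp hCn) ac [wM cM] Ma [wN aN]; split=> //.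
have E : Cn set0 (Iff c (Or a c)).
  apply: (Cn_taut1 hCn ac) => v /=.
  by case: (eval v a); case: (eval v c).
apply: subset_trans aN; rewrite (AGM_extensionality hstar E).
apply: (AGM_disjunctive_inclusion hstar).
by rewrite -(AGM_extensionality hstar E) => /cM /(world_NegP hCn _ wM).
Qed.

Lemma AGM_world_exists a : consistent Cn [set a] -> exists M, best a M.
Proof.
move=> /(AGM_consistency hstar) /(consistent_world hCn a)[M wM aM].
by exists M.
Qed.

Lemma AGM_revision_believed a : K a -> star a = K.
Proof.
move=> Ka; apply/seteqP; split.
  by have := AGM_inclusion hstar (a := a); rewrite expansion_belief_set.
apply: subset_trans (AGM_vacuity hstar _); first exact: sub_expansion.
exact: (consistent_belief_set hCn hK hKcons Ka).
Qed.

(* Grove's sphere of [a]: the worlds that are best for some consequence of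
   [a]. It is the smallest sphere meeting the worlds of [a]. *)
Definition sphere_of a : set (set (form atom)) :=
  [set M | exists2 c, Cn [set a] c & best c M].

Lemma sphere_of_best a M : best a M -> sphere_of a M.
Proof. by move=> aM; exists a => //; apply: (Cn_inclusion hCn). Qed.

Lemma sphere_of_world a M : sphere_of a M -> worlds Cn M.
Proof. by move=> [c _ []]. Qed.

Lemma sphere_of_meet a M : sphere_of a M -> M a -> best a M.
Proof. by move=> [c ac cM]; apply: AGM_world_restrict cM. Qed.

(** If [M] is best for [c] and [N] for [e], then [Or c e], a consequence of [b], has [N] among its
    best worlds. For this one of them must satisfy [e]: if a best world satisfies [c] instead, [M]
    is best too, and [M] satisfies [e] because it satisfies [a]. *)
Lemma sphere_of_least a b M :
  sphere_of b M -> M a -> sphere_of a `<=` sphere_of b.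
Proof.
move=> [c bc cM] Ma N [e ae eN]; have [wM _] := cM; have Mc := AGM_world_self cM.
have cce : Cn [set c] (Or c e) := Cn_Or_l hCn _ (Cn_form_refl hCn c).
have ece : Cn [set e] (Or c e) := Cn_Or_r hCn _ (Cn_form_refl hCn e).
exists (Or c e); first exact: Cn_Or_l.
have [P ceP Pe] : exists2 P, best (Or c e) P & P e.
  have [|P ceP] := @AGM_world_exists (Or c e).
    apply: (world_consistent hCn wM) => _ ->.
    exact: (Cn_form_world hCn cce).
  have [wP _] := ceP.
  have [Pc|Pe] := (world_OrP hCn _ _ wP).1 (AGM_world_self ceP); last by exists P.
  exists M; last exact: (Cn_form_world hCn ae).
  exact: (AGM_world_extend cce ceP Pc cM).
exact: (AGM_world_extend ece ceP Pe eN).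
Qed.

(** A best world of [Or a b] lies in both spheres, as [Or a b] follows from each sentence. It
    satisfies [a] or [b], and [sphere_of_least] compares the spheres accordingly. *)
Lemma sphere_of_total a b : consistent Cn [set a] ->
  sphere_of a `<=` sphere_of b \/ sphere_of b `<=` sphere_of a.
Proof.
have aab := Cn_Or_l hCn b (Cn_form_refl hCn a).
have bab := Cn_Or_r hCn a (Cn_form_refl hCn b).
move=> /(consistent_world hCn a)[M wM aM].
have [|N abN] := @AGM_world_exists (Or a b).
  apply: (world_consistent hCn wM) => _ ->.
  by apply: (Cn_form_world hCn aab wM); apply: aM.
have [wN _] := abN.
have [Na|Nb] := (world_OrP hCn _ _ wN).1 (AGM_world_self abN); [left|right].
  by apply: sphere_of_least Na; exists (Or a b).
by apply: sphere_of_least Nb; exists (Or a b).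
Qed.

(** Exhibits the centre as a Grove sphere, so that [sphere_of_least] applies to it as well.
    Consequences of a theorem are theorems, and revising by them leaves [K] unchanged. *)
Lemma sphere_of_theorem a : Cn set0 a -> sphere_of a = worlds_of Cn K.
Proof.
move=> ta; have Kt c : Cn set0 c -> K c.
  by move=> tc; rewrite hK; apply: (Cn_monotony hCn) tc.
apply/seteqP; split=> [M [c ac]|M KM].
  rewrite AGM_revision_believed //; apply: Kt.
  by apply: (Cn_mp hCn _ ta); apply/(Cn_form_Imp hCn).
by apply: sphere_of_best; rewrite AGM_revision_believed //; apply: Kt.
Qed.

Lemma worlds_sub_sphere_of a : worlds_of Cn K `<=` sphere_of a.
Proof.
move=> M KM; exists (Imp a a); first exact: Cn_Imp_refl.
by rewrite AGM_revision_believed // hK; apply: Cn_Imp_refl.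
Qed.

(* The centre is added by hand because the language may be empty. *)
Definition spheres_of (C : set (form atom)) : set (set (set (form atom))) :=
  [set X | X = worlds_of Cn K \/ exists2 a, C a & X = sphere_of a].

(** Stated for any [C] so as to serve both levels. The last two hypotheses put into [C] every
    sentence true at a world of some sphere, so its own Grove sphere is available as the smallest
    one. *)
Lemma spheres_of_system (C : set (form atom)) :
  element_consistency Cn C ->
  (forall a b M, C b -> sphere_of b M -> M a -> C a) ->
  (forall a M, worlds_of Cn K M -> M a -> C a) ->
  sphere_system Cn K (spheres_of C).
Proof.
move=> Ccons Cmeet Kmeet; split.
- move=> X [->|[a _ ->]] M; first by case.
  exact: sphere_of_world.
- move=> X Y [->|[a Ca ->]] [->|[b Cb ->]]; first by left.
  + by left; apply: worlds_sub_sphere_of.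
  + by right; apply: worlds_sub_sphere_of.
  + by apply: sphere_of_total; apply: Ccons.
- by left.
- by move=> X [->//|[a _ ->]]; apply: worlds_sub_sphere_of.
- move=> a [X SX [M [XM /(world_of_formP hCn)[wM Ma]]]].
  have Ca : C a.
    by case: SX XM => [->|[b Cb ->]] XM; [apply: Kmeet Ma|apply: Cmeet Cb XM Ma].
  exists (sphere_of a); split; first by right; exists a.
    have [N aN] := AGM_world_exists (Ccons _ Ca); have [wN _] := aN.
    exists N; split; first exact: sphere_of_best.
    by apply/(world_of_formP hCn); split=> //; apply: AGM_world_self.
  move=> Y SY [N [YN /(world_of_formP hCn)[wN Na]]].
  case: SY YN => [->|[b Cb ->]] YN; last exact: sphere_of_least Na.
  rewrite -(@sphere_of_theorem (Imp a a)) in YN *.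
    exact: sphere_of_least Na.
  exact: Cn_Imp_refl.
Qed.

End RevisionToSpheres.

(** * The two level system of spheres of an induced operator *)

Lemma revision_induced_sphere_based (atom : Type)
  (Cn : set (form atom) -> set (form atom))
  (hCn : consequence_operation Cn)
  (K : set (form atom)) (hK : belief_set Cn K) (hKcons : consistent Cn K)
  (odot : form atom -> set (form atom)) :
  revision_induced_CL2 Cn K odot -> sphere_based_CL2 Cn K odot.
Proof.
move=> [star [CH [CL [hstar hodot [CLeq CLcons] CHL [CHcons CHlow CHcl HLneg Hneg]]]]].
pose C := CH `|` CL.
have Ccons : element_consistency Cn C by move=> a [/CHcons|/CLcons].
(* The tautology [Imp a a] is in [K], hence in [CH], and revising by it gives back [K]; so [Neg a]
   would be in [K] if [a] were outside [CH]. *)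
have KH a M : worlds_of Cn K M -> M a -> CH a.
  move=> [wM KM] Ma; apply: contrapT => nHa.
  have KT : K (Imp a a) by rewrite hK; apply: Cn_Imp_refl.
  have := Hneg _ _ nHa (CHlow hKcons _ KT).
  by rewrite (AGM_revision_believed hCn hK hKcons hstar KT) => /KM /(world_NegP hCn _ wM).
have Hmeet a b M : CH b -> sphere_of Cn star b M -> M a -> CH a.
  move=> Hb [c bc [wM cM]] Ma; apply: contrapT => nHa.
  by have /cM /(world_NegP hCn _ wM) := Hneg _ _ nHa (CHcl _ Hb _ bc).
(* Sentence closure is assumed for [CH] only. For the union it follows from [HLneg], as a best world
   of [b] satisfies [c]. *)
have Cup b c : C b -> Cn [set b] c -> C c.
  move=> Cb bc; apply: contrapT => nCc; have sn := HLneg _ _ nCc Cb.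
  have [M bM] := AGM_world_exists hCn hstar (Ccons _ Cb); have [wM sM] := bM.
  have /sM /(world_NegP hCn _ wM) := sn; apply.
  exact: (Cn_form_world hCn bc wM (AGM_world_self hstar bM)).
have Cmeet a b M : C b -> sphere_of Cn star b M -> M a -> C a.
  move=> Cb [c bc [wM cM]] Ma; apply: contrapT => nCa.
  by have /cM /(world_NegP hCn _ wM) := HLneg _ _ nCa (Cup _ _ Cb bc).
have sysH : sphere_system Cn K (spheres_of Cn K star CH) by exact: spheres_of_system.
have sysC : sphere_system Cn K (spheres_of Cn K star C).
  by apply: spheres_of_system => // a M KM Ma; left; apply: KH Ma.
have smallestE a X : smallest_intersecting Cn (spheres_of Cn K star C) a X ->
    C a /\ X = sphere_of Cn star a.
  move=> [SX [M [XM /(world_of_formP hCn)[wM Ma]]] minX].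
  have Ca : C a.
    by case: SX XM => [->|[b Cb ->]] XM; [left; apply: KH Ma|apply: Cmeet Cb XM Ma].
  split=> //; apply/seteqP; split.
    have [N aN] := AGM_world_exists hCn hstar (Ccons _ Ca); have [wN _] := aN.
    apply: minX; first by right; exists a.
    exists N; split; first exact: sphere_of_best.
    by apply/(world_of_formP hCn); split=> //; apply: AGM_world_self hstar _ _ aN.
  case: SX XM => [->|[b Cb ->]] XM; last exact: (sphere_of_least hCn hstar XM Ma).
  rewrite -(sphere_of_theorem hCn hK hKcons hstar (a := Imp a a)) in XM *.
    exact: (sphere_of_least hCn hstar XM Ma).
  exact: Cn_Imp_refl.
have meetE a M : (sphere_of Cn star a `&` worlds_of_form Cn a) M <->
    worlds_of Cn (star a) M.
  split=> [[aM /(world_of_formP hCn)[_ Ma]]|aM]; first exact: (sphere_of_meet hCn hstar aM Ma).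
  have [wM _] := aM; split; first exact: sphere_of_best.
  by apply/(world_of_formP hCn); split=> //; apply: (AGM_world_self hstar aM).
exists (spheres_of Cn K star CH), (spheres_of Cn K star C); split.
  split=> //.
    by move=> X [->|[a Ha ->]]; [left|right; exists a => //; left].
  move=> X Y [->|[a Ha ->]] [SY nSY]; first exact: (spheres_min sysC).
  case: SY nSY => [->|[b Cb ->]] nSY; first by case: nSY; left.
  (* If the sphere of [b] lay inside that of [a], a best world of [b] would put [b] into [CH] and
     make its sphere inner. *)
  have [//|ba] := sphere_of_total hCn hstar b (CHcons _ Ha).
  have [N bN] := AGM_world_exists hCn hstar (Ccons _ Cb).
  case: nSY; right; exists b => //; apply: (Hmeet b a N Ha).
    by apply: ba; apply: sphere_of_best.
  exact: (AGM_world_self hstar bN).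
move=> a; have [oH oL oN] := hodot a; split.
- move=> X minX SiX; have [Ca EX] := smallestE _ _ minX.
  have [_ [N [XN /(world_of_formP hCn)[wN Na]]] _] := minX.
  have Ha : CH a.
    by case: SiX XN => [->|[b Hb ->]] XN; [apply: KH Na|apply: Hmeet Hb XN Na].
  rewrite oH // EX; apply/seteqP; split=> x; first by move=> ax M /meetE[_]; apply.
  move=> Hx; apply/(belief_set_worlds hCn _ (AGM_closure hstar a)) => M wM aM.
  by apply: Hx; apply/meetE.
- move=> X minX [_ nSiX]; have [Ca EX] := smallestE _ _ minX.
  have La : CL a.
    by case: Ca => // Ha; case: nSiX; right; exists a.
  rewrite oL // EX; apply/seteqP; split=> x.
    by move=> [ax Kx] M [[_]|/meetE[_]]; apply.
  move=> Hx; split.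
    apply/(belief_set_worlds hCn _ (AGM_closure hstar a)) => M wM aM.
    by apply: Hx; right; apply/meetE.
  by apply/(belief_set_worlds hCn _ hK) => M wM KM; apply: Hx; left.
- move=> none; apply: oN => Ca.
  have [N aN] := AGM_world_exists hCn hstar (Ccons _ Ca).
  have : (sphere_of Cn star a `&` worlds_of_form Cn a) N by apply/meetE.
  by rewrite none //; right; exists a.
Qed.

(** * From two level systems of spheres to the postulates *)

Section SpheresToPostulates.
Variables (atom : Type) (Cn : set (form atom) -> set (form atom)).
Hypothesis hCn : consequence_operation Cn.
Variables (K : set (form atom)) (odot : form atom -> set (form atom)).
Hypotheses (hK : belief_set Cn K) (hKcons : consistent Cn K).
Variables Si S : set (set (set (form atom))).
Hypothesis hS : two_level_sphere_system Cn K Si S.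
Hypothesis hodot : forall a,
  [/\ forall X, smallest_intersecting Cn S a X -> Si X ->
        odot a = meet_worlds (X `&` worlds_of_form Cn a),
      forall X, smallest_intersecting Cn S a X -> (S `\` Si) X ->
        odot a = meet_worlds (worlds_of Cn K `|` (X `&` worlds_of_form Cn a)) &
      (forall X, S X -> X `&` worlds_of_form Cn a = set0) -> odot a = K].
Implicit Types (M : set (form atom)) (X Y : set (set (form atom))).
Implicit Types a b c x : form atom.

Let hSS := two_level_outer hS.

Lemma sphere_world X M : S X -> X M -> worlds Cn M.
Proof. by move=> /(spheres_worlds hSS); apply. Qed.

Lemma sphere_intersectsP X a :
  S X -> intersects X (worlds_of_form Cn a) <-> exists2 M, X M & M a.
Proof.
move=> SX; split=> [[M [XM /(world_of_formP hCn)[_ Ma]]]|[M XM Ma]]; first by exists M.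
by exists M; split=> //; apply/world_of_formP => //; split=> //; apply: (sphere_world _ XM).
Qed.

Lemma smallest_sphere_unique a X Y : smallest_intersecting Cn S a X ->
  smallest_intersecting Cn S a Y -> X = Y.
Proof.
move=> [SX aX minX] [SY aY minY].
by apply/seteqP; split; [apply: minX|apply: minY].
Qed.

Lemma smallest_sphere_imp a c X M : Cn [set a] c ->
  smallest_intersecting Cn S c X -> X M -> M a -> smallest_intersecting Cn S a X.
Proof.
move=> ac [SX cX minX] XM Ma; split=> //; first by apply/sphere_intersectsP => //; exists M.
move=> Y SY /(sphere_intersectsP _ SY)[N YN Na]; apply: minX => //.
apply/sphere_intersectsP => //; exists N => //.
exact: (Cn_form_world hCn ac (sphere_world SY YN) Na).
Qed.

Lemma smallest_sphere_center a M : worlds_of Cn K M -> M a ->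
  smallest_intersecting Cn S a (worlds_of Cn K).
Proof.
move=> KM Ma; have SK := spheres_center hSS; split=> //.
  by apply/sphere_intersectsP => //; exists M.
by move=> Y SY _; apply: (spheres_min hSS).
Qed.

(** The three clauses with the intersections unfolded, so that the postulates can be checked world
    by world. *)
Variant sphere_revision_spec a : Prop :=
| RevisionInner X of smallest_intersecting Cn S a X & Si X &
    (exists2 M, X M & M a) &
    (forall x, odot a x <-> forall M, X M -> M a -> M x)
| RevisionOuter X of smallest_intersecting Cn S a X & ~ Si X &
    (exists2 M, X M & M a) &
    (forall x, odot a x <-> K x /\ forall M, X M -> M a -> M x)
| RevisionNone of (forall X M, S X -> X M -> ~ M a) & odot a = K.

Lemma sphere_revisionP a : sphere_revision_spec a.
Proof.
have [hi ho hn] := hodot a.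
have [[X SX aX]|none] := pselect (exists2 X, S X & intersects X (worlds_of_form Cn a)).
  have [|Y minY] := spheres_smallest hSS (a := a); first by exists X.
  have [SY aY _] := minY.
  have exM := (sphere_intersectsP a SY).1 aY.
  have aE M : Y M -> M a -> (Y `&` worlds_of_form Cn a) M.
    by move=> YM Ma; split=> //; apply/world_of_formP => //; split=> //; apply: (sphere_world _ YM).
  have [SiY|nSiY] := pselect (Si Y).
    apply: (RevisionInner minY SiY exM) => x; rewrite (hi _ minY SiY).
    split=> [H M YM Ma|H M [YM /(world_of_formP hCn)[_ Ma]]]; last exact: H.
    by apply: H; apply: aE.
  apply: (RevisionOuter minY nSiY exM) => x; rewrite (ho _ minY (conj SY nSiY)).
  split=> [H|[Kx H] M [[wM KM]|[YM /(world_of_formP hCn)[_ Ma]]]]; [|exact: KM|exact: H].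
  split; first by apply/(belief_set_worlds hCn _ hK) => M wM KM; apply: H; left.
  by move=> M YM Ma; apply: H; right; apply: aE.
apply: RevisionNone.
  move=> X M SX XM Ma; apply: none; exists X => //.
  by apply/sphere_intersectsP => //; exists M.
apply: hn => X SX; apply/seteqP; split=> // M XM; apply: none.
by exists X => //; exists M.
Qed.

(** The centre is then the smallest sphere and belongs to the inner level. This yields inclusion and
    vacuity. *)
Lemma sphere_revision_compatible a M : worlds_of Cn K M -> M a ->
  forall x, odot a x <-> forall N, worlds_of Cn K N -> N a -> N x.
Proof.
move=> KM Ma; have minK := smallest_sphere_center KM Ma.
have SiK := spheres_center (two_level_inner hS).
case: (sphere_revisionP a) => [X minX _ _ H|X minX nSiX|none].
- by rewrite (smallest_sphere_unique minK minX).
- by case: nSiX; rewrite -(smallest_sphere_unique minK minX).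
- by case: (none _ _ (spheres_center hSS) KM).
Qed.

Lemma compatible_world a :
  ~ K (Neg a) -> exists2 M, worlds_of Cn K M & M a.
Proof.
rewrite {1}hK => /(Lindenbaum hCn)[M [wM KM nMa]].
exists M => //; apply: contrapT => /(world_NegP hCn _ wM); exact: nMa.
Qed.

(** A description common to the three clauses, from which closure and N-persistence follow. *)
Lemma sphere_revision_worlds a : exists2 D, D `<=` worlds Cn /\
   (forall M, D M -> exists2 X, S X & X M) & odot a = meet_worlds D.
Proof.
case: (sphere_revisionP a) => [X [SX _ _] _ _ H|X [SX _ _] _ _ H|_ ->].
- exists [set M | X M /\ M a].
    by split=> M [XM _]; [apply: (sphere_world _ XM)|exists X].
  by apply/seteqP; split=> x; rewrite H => Hx M; [case; apply: Hx|move=> XM Ma; apply: Hx].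
- exists [set M | worlds_of Cn K M \/ X M /\ M a].
    split=> M [KM|[XM _]]; [by case: KM|exact: (sphere_world SX XM)| |by exists X].
    by exists (worlds_of Cn K) => //; apply: spheres_center hSS.
  apply/seteqP; split=> x; rewrite H; first by move=> [Kx Hx] M [[_]|[]]; [apply|apply: Hx].
  move=> Hx; split=> [|M XM Ma]; last by apply: Hx; right.
  by apply/(belief_set_worlds hCn _ hK) => M wM KM; apply: Hx; left.
- exists (worlds_of Cn K).
    split=> [M []//|M KM]; exists (worlds_of Cn K) => //; apply: spheres_center hSS.
  apply/seteqP; split=> x Hx; first by move=> M [_]; apply.
  by apply/(belief_set_worlds hCn _ hK) => M wM KM; apply: Hx.
Qed.

(** Outside the inner clause [odot a] lies in [K], so [a] is believed, and the nonempty centre is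
    the smallest sphere after all. *)
Lemma sphere_revision_success a : odot a a ->
  exists2 X, smallest_intersecting Cn S a X & Si X.
Proof.
move=> aa; have Kaa : K a -> exists2 X, smallest_intersecting Cn S a X & Si X.
  move=> Ka; exists (worlds_of Cn K); last exact: spheres_center (two_level_inner hS).
  have [M wM KM] := consistent_world hCn a hKcons.
  by apply: (@smallest_sphere_center _ M); [split|apply: KM].
case: (sphere_revisionP a) => [X minX SiX _ _|X _ _ _ H|_ E]; first by exists X.
  by apply: Kaa; case/H: aa.
by apply: Kaa; rewrite -E.
Qed.

Lemma smallest_sphere_Or a b X M : smallest_intersecting Cn S (Or a b) X ->
  X M -> M (Or a b) -> M a /\ smallest_intersecting Cn S a X \/
  M b /\ smallest_intersecting Cn S b X.
Proof.
move=> minX XM Mab; have [SX _ _] := minX.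
move/(world_OrP hCn _ _ (sphere_world SX XM)): Mab => [Ma|Mb]; [left|right];
  split=> //; apply: (smallest_sphere_imp _ minX XM) => //.
  exact: (Cn_Or_l hCn b (Cn_form_refl hCn a)).
exact: (Cn_Or_r hCn a (Cn_form_refl hCn b)).
Qed.

Lemma sphere_revision_sub a X M x : smallest_intersecting Cn S a X ->
  X M -> M a -> odot a x -> M x.
Proof.
move=> minX XM Ma; have [SX _ _] := minX.
case: (sphere_revisionP a) => [Y minY _ _ ->|Y minY _ _ ->|/(_ _ _ SX XM)//];
  rewrite (smallest_sphere_unique minY minX); [|case=> _]; exact.
Qed.

Lemma sphere_revision_outer a X : smallest_intersecting Cn S a X -> ~ Si X ->
  odot a `<=` K.
Proof.
move=> minX nSiX; case: (sphere_revisionP a) => [Y minY SiY|Y _ _ _ H x /H[]//|_ ->//].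
by case: nSiX; rewrite (smallest_sphere_unique minX minY).
Qed.

Lemma spheres_postulates : CL2_postulates Cn K odot.
Proof.
have clo a : belief_set Cn (odot a).
  by have [D [Dw _] ->] := sphere_revision_worlds a; apply: meet_worlds_belief_set.
split=> //.
- move=> a; case: (sphere_revisionP a) => [X _ _ _ ->|X _ _ _ H|_ ->]; [by left| |by right].
  by right=> x /H[].
- move=> a x ax; apply: (Cn_worlds hCn) => M wM KaM.
  have KM : worlds_of Cn K M by split=> // y Ky; apply: KaM; left.
  have Ma : M a by apply: KaM; right.
  exact: ((sphere_revision_compatible KM Ma x).1 ax _ KM Ma).
- move=> a _; case: (sphere_revisionP a) =>
    [X [SX _ _] _ [M XM Ma] H|X [SX _ _] _ [M XM Ma] H|_ ->//].
    by apply: (world_consistent hCn (sphere_world SX XM)) => x /H; apply.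
  by apply: (world_consistent hCn (sphere_world SX XM)) => x /H[_]; apply.
- move=> a /compatible_world[M KM Ma] x Kax.
  apply/(sphere_revision_compatible KM Ma) => N [wN KN] Na.
  apply: (world_Cn hCn wN); apply: (Cn_monotony hCn) Kax => y [/KN//|->//].
- move=> a b ab.
  have [Cab Cba] : Cn [set a] b /\ Cn [set b] a.
    by split; apply/(Cn_form_Imp hCn); apply: (Cn_taut1 hCn ab) => v /= /eqP ->;
      exact: implybb.
  have MM X M : S X -> X M -> M a <-> M b.
    by move=> SX /(sphere_world SX) wM; split; apply: (Cn_form_world hCn).
  have mm X : smallest_intersecting Cn S a X -> smallest_intersecting Cn S b X.
    move=> minX; have [SX aX _] := minX.
    have [M XM Ma] := (sphere_intersectsP a SX).1 aX.
    by apply: (smallest_sphere_imp _ minX XM) => //; apply/(MM X M SX XM).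
  apply/funext => x; apply/propext.
  have [hi ho hn] := hodot b.
  case: (sphere_revisionP a) => [X minX SiX [M XM Ma] H|X minX nSiX [M XM Ma] H|none ->].
  + case: (sphere_revisionP b) => [Y minY _ _ H'|Y minY nSiY|none].
    * have EYX := smallest_sphere_unique minY (mm _ minX); subst Y.
      have [SX _ _] := minX; rewrite H H'.
      by split=> Hx N XN /(MM X N SX XN); apply: Hx.
    * by case: nSiY; rewrite (smallest_sphere_unique minY (mm _ minX)).
    * have [SX _ _] := minX.
      by case: (none X M SX XM); apply/(MM X M SX XM).
  + case: (sphere_revisionP b) => [Y minY SiY|Y minY _ _ H'|none].
    * by case: nSiX; rewrite -(smallest_sphere_unique minY (mm _ minX)).
    * have EYX := smallest_sphere_unique minY (mm _ minX); subst Y.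
      have [SX _ _] := minX; rewrite H H'.
      by split=> -[Kx Hx]; split=> // N XN /(MM X N SX XN); apply: Hx.
    * have [SX _ _] := minX.
      by case: (none X M SX XM); apply/(MM X M SX XM).
  + rewrite hn // => X SX; apply/seteqP; split=> // N [XN /(world_of_formP hCn)[_ Nb]].
    by apply: (none X N SX XN); apply/(MM X N SX XN).
- move=> a b /sphere_revision_success[X minX SiX] /(Cn_form_Imp hCn) ab.
  have [SX aX _] := minX; have [M XM Ma] := (sphere_intersectsP a SX).1 aX.
  have Mb := Cn_form_world hCn ab (sphere_world SX XM) Ma.
  case: (sphere_revisionP b) => [Y _ _ _ ->//|Y [SY bY minY] nSiY _ _|/(_ _ _ SX XM)//].
  (* Minimality puts [Y] inside [X], while an outer sphere contains the inner [X]; so [Y] would be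
     inner. *)
  have SYi : (S `\` Si) Y by [].
  case: nSiY; suff -> : Y = X by [].
  apply/seteqP; split; last exact: (two_level_below hS).
  by apply: minY => //; apply/sphere_intersectsP => //; exists M.
- move=> a b bnb; case: (sphere_revisionP b) =>
    [X [SX _ _] _ [M XM Mb] H|X [SX _ _] _ [M XM Mb] H|none _].
  + by have /(world_NegP hCn _ (sphere_world SX XM)) := (H _).1 bnb M XM Mb.
  + by have /(world_NegP hCn _ (sphere_world SX XM)) := ((H _).1 bnb).2 M XM Mb.
  (* No sphere has a world satisfying [b], and [odot a] is an intersection of worlds taken from
     spheres. *)
  + have [D [Dw DS] ->] := sphere_revision_worlds a.
    move=> M DM; apply/(world_NegP hCn _ (Dw _ DM)).
    by have [X SX XM] := DS _ DM; apply: none XM.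
- move=> a x Kx; apply/(expansion_Imp hCn); rewrite -clo.
  (* [Imp (Neg a) x] holds throughout [K] because of [x], and at every world of [a] vacuously. *)
  have Kax : K (Imp (Neg a) x).
    by rewrite hK; apply: (Cn_taut1 hCn (Cn_inclusion hCn Kx)) => v /= ->; rewrite implybT.
  have ax M : worlds Cn M -> M a -> M (Imp (Neg a) x).
    by move=> wM Ma; apply: (world_taut2 hCn wM Ma Ma) => v /= ->.
  case: (sphere_revisionP a) => [X [SX _ _] _ _ ->|X [SX _ _] _ _ ->|_ ->//].
    by move=> M XM Ma; apply: ax => //; apply: (sphere_world _ XM).
  by split=> // M XM Ma; apply: ax => //; apply: (sphere_world _ XM).
- move=> a b x [ax bx].
  case: (sphere_revisionP (Or a b)) => [X minX SiX _ ->|X minX nSiX [N XN Nab] ->|none ->].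
  + move=> M XM /(smallest_sphere_Or minX XM)[[Ma mX]|[Mb mX]].
      exact: (sphere_revision_sub mX XM Ma ax).
    exact: (sphere_revision_sub mX XM Mb bx).
  + split.
      by have [[_ mX]|[_ mX]] := smallest_sphere_Or minX XN Nab;
        [apply: (sphere_revision_outer mX nSiX ax)|apply: (sphere_revision_outer mX nSiX bx)].
    move=> M XM /(smallest_sphere_Or minX XM)[[Ma mX]|[Mb mX]].
      exact: (sphere_revision_sub mX XM Ma ax).
    exact: (sphere_revision_sub mX XM Mb bx).
  + case: (sphere_revisionP a) => [X [SX _ _] _ [M XM Ma] _|X [SX _ _] _ [M XM Ma] _|_ <-//];
      by case: (none X M SX XM); apply/(world_OrP hCn _ _ (sphere_world SX XM)); left.
- move=> a b nna.
  have aab := Cn_Or_l hCn b (Cn_form_refl hCn a).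
  case: (sphere_revisionP (Or a b)) => [X minX SiX _ H|X minX nSiX [N XN Nab] H|none E].
  + have [SX _ _] := minX; have [M XM Ma] : exists2 M, X M & M a.
      apply: contrapT => no; apply: nna; apply/H => M XM Mab.
      apply/(world_NegP hCn _ (sphere_world SX XM)) => Ma; apply: no; by exists M.
    have mX := smallest_sphere_imp aab minX XM Ma.
    case: (sphere_revisionP a) => [Y mY _ _ H'|Y mY nSiY|/(_ _ _ SX XM)//].
      move=> x /H Hx; apply/H'; rewrite (smallest_sphere_unique mY mX) => P XP Pa.
      by apply: Hx => //; apply: (Cn_form_world hCn aab) => //; apply: (sphere_world _ XP).
    by case: nSiY; rewrite (smallest_sphere_unique mY mX).
  (* A world of [K] satisfying [a] would make the centre, which is inner, the smallest sphere for
     [Or a b]. *)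
  + have [SX _ _] := minX; have Kn : K (Neg a).
      apply: contrapT => /compatible_world[M KM Ma].
      have minK := smallest_sphere_center KM (Cn_form_world hCn aab KM.1 Ma).
      apply: nSiX; rewrite (smallest_sphere_unique minX minK).
      exact: spheres_center (two_level_inner hS).
    have [M XM Ma] : exists2 M, X M & M a.
      apply: contrapT => no; apply: nna; apply/H; split=> // M XM Mab.
      apply/(world_NegP hCn _ (sphere_world SX XM)) => Ma; apply: no; by exists M.
    have mX := smallest_sphere_imp aab minX XM Ma.
    case: (sphere_revisionP a) => [Y mY SiY|Y mY nSiY _ H'|/(_ _ _ SX XM)//].
      by case: nSiX; rewrite (smallest_sphere_unique mX mY).
    move=> x /H[Kx Hx]; apply/H'; split=> //.
    rewrite (smallest_sphere_unique mY mX) => P XP Pa.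
    by apply: Hx => //; apply: (Cn_form_world hCn aab) => //; apply: (sphere_world _ XP).
  + move: nna; rewrite E => /compatible_world[M KM Ma].
    case: (none _ _ (spheres_center hSS) KM).
    exact: (Cn_form_world hCn aab KM.1 Ma).
Qed.

End SpheresToPostulates.

Theorem theorem1 (atom : Type) (Cn : set (form atom) -> set (form atom))
  (hCn : consequence_operation Cn)
  (K : set (form atom)) (hK : belief_set Cn K) (hKcons : consistent Cn K)
  (odot : form atom -> set (form atom)) :
  (CL2_postulates Cn K odot <-> sphere_based_CL2 Cn K odot) /\
  (sphere_based_CL2 Cn K odot <-> revision_induced_CL2 Cn K odot).
Proof.
have h12 := postulates_revision_induced hCn hK hKcons.
have h23 := revision_induced_sphere_based hCn hK hKcons.
have h31 : sphere_based_CL2 Cn K odot -> CL2_postulates Cn K odot.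
  by move=> [Si [S [hS hodot]]]; apply: (spheres_postulates hCn hK hKcons hS hodot).
by split; split=> h; auto.
Qed.
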